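(* Let $\alpha_s=2^s$ for $s\ge1$, $A_0=0$, $A_k=\sum_{i=1}^k\alpha_i$, and let the weights $\mu_s$, $s\in\mathbb N_0$, be given for $k=0,1,2,\dots$ by $$\mu_s=\begin{cases}\dfrac{C}{2(k+1)^{3/2}},& s=A_k,\\[2mm] \dfrac{1}{A_{k+1}-A_k-1}\cdot\dfrac{C}{2(k+1)^{3/2}},& A_k<s\le A_{k+1}-1,\end{cases}\qquad C=\Big(\sum_{k=0}^\infty\frac1{(k+1)^{3/2}}\Big)^{-1}.$$ Then $\mathfrak H(\mathbf B_\alpha)=\infty$.
   Context: For an integer $m\ge1$ let $\mathbf E_m$ be the $m\times m$ matrix all of whose entries equal $1/m$. For a non-decreasing sequence of positive integers $\alpha=(\alpha_k)_{k\ge1}$ let $\mathbf B_\alpha=\mathrm{diag}(\mathbf E_{\alpha_1},\mathbf E_{\alpha_2},\dots)$ be the block-diagonal operator on $l^1(\mathbb N_0)$, $\mathbb N_0=\{0,1,\dots\}$. Given weights $\mu_j>0$ with $\sum_{j\in\mathbb N_0}\mu_j=1$ and an infinite matrix $\mathbf B=(\mathbf B_{jk})_{j,k\in\mathbb N_0}$ with nonnegative entries and all row and column sums at most $1$, let $\mathbf B_J=(\mathbf B_{jk})_{0\le j,k<J}$ and let $\mathcal P_J$ be the projection of $\mathbb C^J$ onto $\mathrm{Ker}(\mathbf B_J-I)$ along $\mathrm{Im}(\mathbf B_J-I)$ (these are complementary). With $e=(1,\dots,1)$, $\mu^{(J)}=(\mu_0,\dots,\mu_{J-1})$, $0\log0=0$,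 put $$\mathfrak h(\mathbf B_J)=-\sum_{j,k=0}^{J-1}(\mathcal P_J^Te)_j(\mathbf B_J)_{jk}(\mathcal P_J\mu^{(J)})_k\log(\mathbf B_J)_{jk},\qquad \mathfrak H(\mathbf B)=\lim_{J\to\infty}\mathfrak h(\mathbf B_J)\in[0,\infty].$$ *)

(* Defs.v *)
From HB Require Import structures.
From mathcomp Require Import all_boot all_order all_algebra.
From mathcomp Require Import complex.
From mathcomp Require Import all_classical all_reals all_analysis.

Set Implicit Arguments.
Unset Strict Implicit.
Unset Printing Implicit Defensive.

Import Order.TTheory GRing.Theory Num.Theory.
Import numFieldNormedType.Exports.

Local Open Scope ring_scope.
Local Open Scope complex_scope.

(* The sequence alpha is indexed from 1; the value alpha 0 is never used. *)
Definition blockStart (alpha : nat -> nat) (k : nat) : nat :=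
  (\sum_(1 <= i < k.+1) alpha i)%N.

Definition Emx (R : realType) (m : nat) : 'M[R]_m := const_mx (m%:R^-1).

(* Infinite matrices indexed by N_0 x N_0 are functions nat -> nat -> R.
   diag(E_{alpha 1}, E_{alpha 2}, ...): the block E_{alpha n.+1} occupies the
   indices blockStart alpha n + p for p < alpha n.+1.  When all alpha i are
   positive, n <= blockStart alpha n, so only the blocks n <= j can meet row j
   and the sum has at most one nonzero term. *)
Definition Balpha (R : realType) (alpha : nat -> nat) (j k : nat) : R :=
  \sum_(n < j.+1)
    \sum_(p < alpha n.+1 | (blockStart alpha n + p == j)%N)
      \sum_(q < alpha n.+1 | (blockStart alpha n + q == k)%N)
        Emx R (alpha n.+1) p q.

Definition trunc (R : realType) (B : nat -> nat -> R) (J : nat) : 'M[R]_J :=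
  \matrix_(j, k) B j k.

(* The matrix, acting on column vectors, of the projection onto Ker (A - I)
   along Im (A - I).  Since kermx and proj_mx act on row vectors, it is
   obtained from the row kernel and row space of (A - I)^T by transposition. *)
Definition kerImProj (F : fieldType) (J : nat) (A : 'M[F]_J) : 'M[F]_J :=
  let N := (A - 1%:M)^T in (proj_mx (kermx N) N)^T.

(* The projection lives on C^J; the entropy is a real number, read off by Re.
   The convention 0 log 0 = 0 holds because ln 0 = 0. *)
Definition frakh (R : realType) (mu : nat -> R) (B : nat -> nat -> R)
    (J : nat) : R :=
  let BJ : 'M[R]_J := trunc B J in
  let P : 'M[R[i]]_J := kerImProj (map_mx (real_complex R) BJ) in
  let e : 'cV[R[i]]_J := const_mx 1 in
  let muJ : 'cV[R[i]]_J := \col_k (mu k)%:C in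
  complex.Re (- \sum_(j < J) \sum_(k < J)
    (P^T *m e) j 0 * (BJ j k)%:C * (P *m muJ) k 0 * (ln (BJ j k))%:C).

Definition frakH (R : realType) (mu : nat -> R) (B : nat -> nat -> R) :
    \bar R :=
  limn (fun J => (frakh mu B J)%:E).

(* Main.v *)
(* If the index J lies in block K, the truncation B_J is the sum of the K full
   blocks, an idempotent Q, and of a truncated block T with T^2 = rho T and
   rho < 1.  Hence 1 is an eigenvalue of the full blocks only and P_J = Q.
   Each full block E_m then contributes log m times the mu-mass of the block to
   h(B_J).  Here block n has log m = (n+1) log 2 and mass C / (n+1)^(3/2), so
   h(B_J) is C log 2 times a partial sum of the divergent series of
   (n+1)^(-1/2), while C > 0 because the series of (n+1)^(-3/2) converges. *)
Require Import Defs.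
From mathcomp Require Import all_boot all_order all_algebra.
From mathcomp Require Import complex.
From mathcomp Require Import all_classical all_reals all_analysis.
From mathcomp Require Import ring lra zify.

Import Order.TTheory GRing.Theory Num.Theory.
Import numFieldNormedType.Exports.
Local Open Scope ring_scope.

(** * Projections onto kernels along images *)

(** The relations with [X] express [1 - P] through [A - 1]: hence [P] fixes [Ker (A - 1)], and
    [1 - P] maps into [Im (A - 1)]. *)
Lemma kerImProj_unique (F : fieldType) (J : nat) (A P X : 'M[F]_J) :
  P *m (A - 1%:M) = 0 -> (A - 1%:M) *m P = 0 ->
  X *m (A - 1%:M) = 1%:M - P -> (A - 1%:M) *m X = 1%:M - P ->
  kerImProj A = P.
Proof.
rewrite /kerImProj; set N := A - 1%:M => PN NP XN NX.
have trPN : N^T *m P^T = 0 by rewrite -trmx_mul PN trmx0.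
have trNP : P^T *m N^T = 0 by rewrite -trmx_mul NP trmx0.
have trXN : N^T *m X^T = 1%:M - P^T by rewrite -trmx_mul XN linearB /= trmx1.
have trNX : X^T *m N^T = 1%:M - P^T by rewrite -trmx_mul NX linearB /= trmx1.
have cap0 : (kermx N^T :&: N^T)%MS = 0.
  apply/eqP; rewrite -submx0; apply/rV_subP => u.
  rewrite sub_capmx => /andP[/sub_kermxP uN0 /submxP[v uE]]; rewrite submx0.
  rewrite -[u]mulmx1 -[1%:M](subrK P^T) -trXN mulmxDr mulmxA uN0 mul0mx add0r.
  by rewrite uE -mulmxA trPN mulmx0.
rewrite -[P]trmxK; congr (_^T).
(* The projection is applied to [1 = (1 - P^T) + P^T]: the rows of [P^T] lie in the kernel, those of
   [1 - P^T = X^T N^T] in the row space. *)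
rewrite -[LHS]mul1mx -[1%:M](subrK P^T) mulmxDl addrC.
rewrite proj_mx_id ?proj_mx_0 ?addr0 //; first by rewrite -trNX submxMl.
exact/sub_kermxP.
Qed.

(** On the image of [Q] the matrix [Q + T - 1] vanishes; on the kernel of [Q] it is [T - 1],
    invertible since the eigenvalues of [T] are among 0 and [rho]. *)
Lemma kerImProj_idem_add (F : fieldType) (J : nat) (Q T : 'M[F]_J) (rho : F) :
  Q *m Q = Q -> Q *m T = 0 -> T *m Q = 0 -> T *m T = rho *: T -> rho != 1 ->
  kerImProj (Q + T) = Q.
Proof.
move=> QQ QT TQ TT rho1.
have r0 : 1 - rho != 0 by rewrite subr_eq0 eq_sym.
(* the inverse of [T - 1] is [- (1 + T / (1 - rho))] *)
apply: (@kerImProj_unique _ _ _ _ (- 1%:M - (1 - rho)^-1 *: T)).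
- by rewrite mulmxBr mulmxDr QQ QT mulmx1 addr0 subrr.
- by rewrite mulmxBl mulmxDl QQ TQ mul1mx addr0 subrr.
- rewrite mulmxBl mulNmx mul1mx -scalemxAl mulmxBr mulmxDr TQ TT mulmx1.
  by apply/matrixP => i j; rewrite !mxE; field.
- rewrite mulmxBr mulmxN mulmx1 -scalemxAr mulmxBl mulmxDl QT TT mul1mx.
  by apply/matrixP => i j; rewrite !mxE; field.
Qed.

(** * Truncations of the block-diagonal matrix and their entropy *)

Lemma blockStartS (alpha : nat -> nat) (n : nat) :
  blockStart alpha n.+1 = (blockStart alpha n + alpha n.+1)%N.
Proof. by rewrite /blockStart big_nat_recr. Qed.

Lemma sum_offset (V : nmodType) (a m j : nat) (c : V) :
  \sum_(p < m | (a + p == j)%N) c = if (a <= j < a + m)%N then c else 0.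
Proof.
case: ifP => [/andP[aj jam]|aj].
  have jm : (j - a < m)%N by lia.
  by rewrite (big_pred1 (Ordinal jm)) // => p; apply/eqP/eqP => [apj|->];
    [apply/val_inj => /=; lia | rewrite /=; lia].
rewrite big1// => p /eqP apj; move: aj; rewrite -apj.
by have := ltn_ord p; lia.
Qed.

(* [b j] is the index of the block containing [j]. *)
Section block_diagonal.

Set Implicit Arguments.
Unset Strict Implicit.
Variables (R : realType) (alpha b : nat -> nat).
Hypothesis alpha_gt0 : forall n, (0 < alpha n.+1)%N.
(** Equality for all [n] encodes both that [j] lies in a block (take [n := b j]) and that it lies in
    only one. *)
Hypothesis bP : forall j n,
  (b j == n) = (blockStart alpha n <= j < blockStart alpha n.+1)%N.

Lemma leq_blockStart (n : nat) : (n <= blockStart alpha n)%N.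
Proof.
elim: n => // n IHn; rewrite blockStartS.
by have := alpha_gt0 n; lia.
Qed.

Lemma blockStart_homo (m n : nat) :
  (m <= n)%N -> (blockStart alpha m <= blockStart alpha n)%N.
Proof.
by apply: (homo_leq leqnn leq_trans) => k; rewrite blockStartS leq_addr.
Qed.

Lemma block_bounds (j : nat) :
  (blockStart alpha (b j) <= j < blockStart alpha (b j).+1)%N.
Proof. by rewrite -bP. Qed.

Lemma leq_block (j k : nat) : (j <= k)%N -> (b j <= b k)%N.
Proof.
move=> jk; rewrite leqNgt; apply/negP => /blockStart_homo bkj.
by have := block_bounds j; have := block_bounds k; lia.
Qed.

Lemma Balpha_block (j k : nat) :
  Balpha R alpha j k = if b j == b k then (alpha (b j).+1)%:R^-1 else 0.
Proof.
(* The outer sum of [Balpha] reaches the block of [j], as [b j <= blockStart alpha (b j) <= j]. *)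
have bj : (b j < j.+1)%N.
  by have := leq_blockStart (b j); have := block_bounds j; lia.
rewrite /Balpha (bigD1 (Ordinal bj)) //= [X in _ + X]big1 => [|n nj].
  under eq_bigr do under eq_bigr do rewrite mxE.
  by rewrite !sum_offset -!blockStartS -!bP eqxx [b k == _]eq_sym addr0.
under eq_bigr do under eq_bigr do rewrite mxE.
rewrite !sum_offset -!blockStartS -!bP; case: eqP => // bjn.
by case/eqP: nj; apply/val_inj.
Qed.

(** A block before that of [J] ends no later than [J], so the truncation keeps all its indices. *)
Lemma sum_block (V : nmodType) (J n : nat) (F : nat -> V) : (n < b J)%N ->
  \sum_(k < J | b k == n) F k =
  \sum_(blockStart alpha n <= k < blockStart alpha n.+1) F k.
Proof.
move=> nJ; have := blockStart_homo nJ; have := block_bounds J => /andP[AJ _] AnJ.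
rewrite (big_nat_widenl _ 0)// (@big_nat_widen _ _ _ _ _ J) ?(leq_trans AnJ)//.
by rewrite big_mkord; apply: eq_bigl => k; rewrite bP.
Qed.

Lemma card_full_block (J n : nat) : (n < b J)%N ->
  \sum_(k < J | b k == n) 1 = (alpha n.+1)%:R :> R.
Proof.
move=> /(@sum_block R J n (fun=> 1)) ->.
by rewrite sumr_const_nat blockStartS addKn.
Qed.

Lemma card_last_block (J : nat) :
  \sum_(k < J | b k == b J) 1 = (J - blockStart alpha (b J))%:R :> R.
Proof.
have /andP[AJ JA] := block_bounds J.
rewrite -sumr_const_nat (big_nat_widenl _ 0)// big_mkord.
apply: eq_bigl => k; rewrite bP andb_idr// => _.
exact: ltn_trans (ltn_ord k) JA.
Qed.

(** Columns of a full block sum to 1, so weights constant on blocks pass through [Balpha]. In the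
    cut block the column sums fall below 1, whence the vanishing of [f] there. *)
Lemma sum_Balpha (J k : nat) (f : nat -> R) :
  (forall n, (b J <= n)%N -> f n = 0) ->
  \sum_(j < J) Balpha R alpha j k * f (b j) = f (b k).
Proof.
move=> f0; transitivity (\sum_(j < J | b j == b k)
    (1 * ((alpha (b k).+1)%:R^-1 * f (b k)))).
  rewrite [RHS]big_mkcond; apply: eq_bigr => j _.
  by rewrite Balpha_block mul1r; case: eqP => [->//|_]; rewrite mul0r.
have [/f0->|bk] := leqP (b J) (b k); first by rewrite big1// => j; rewrite !mulr0.
rewrite -mulr_suml card_full_block// mulrA divff ?mul1r//.
by rewrite pnatr_eq0 -lt0n.
Qed.

(** Testing the column alone suffices: entries joining different blocks are already 0. *)
Definition full_blocks (J : nat) : 'M[R]_J :=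
  \matrix_(j, k) if (b k < b J)%N then Balpha R alpha j k else 0.

Definition last_block (J : nat) : 'M[R]_J :=
  \matrix_(j, k) if b k == b J then Balpha R alpha j k else 0.

Lemma trunc_Balpha (J : nat) :
  trunc (Balpha R alpha) J = full_blocks J + last_block J.
Proof.
apply/matrixP => j k; rewrite !mxE.
by have := leq_block (ltnW (ltn_ord k)); case: ltngtP => // _ _;
  rewrite ?addr0 ?add0r.
Qed.

Lemma full_blocks_idem (J : nat) :
  full_blocks J *m full_blocks J = full_blocks J.
Proof.
apply/matrixP => j l; rewrite !mxE.
(* Column [l] of [full_blocks J] as a function of the block of the row; symmetry of [Balpha] then
   turns the product into a sum for [sum_Balpha]. *)
pose f n := if (n < b J)%N && (n == b l) then (alpha n.+1)%:R^-1 else 0 : R.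
transitivity (f (b j)).
  rewrite -(@sum_Balpha J).
    apply: eq_bigr => k _; rewrite !mxE !Balpha_block /f [b k == b j]eq_sym.
    case: (b j =P b k) => [jk|_]; last by rewrite if_same !mul0r.
    case: (b k =P b l) => [kl|_]; last by rewrite !if_same andbF !mulr0.
    by rewrite -kl andbT jk; case: ifP => // _; rewrite !mulr0.
  by move=> n nJ; rewrite /f ltnNge nJ.
rewrite /f Balpha_block; case: (b j =P b l) => [->|_]; last first.
  by rewrite andbF if_same.
by rewrite andbT.
Qed.

Lemma full_last_blocks (J : nat) : full_blocks J *m last_block J = 0.
Proof.
apply/matrixP => j l; rewrite !mxE big1// => k _; rewrite !mxE !Balpha_block.
case: ltnP => kJ; last by rewrite mul0r.
case: (b k =P b l) => [<-|_]; last by rewrite if_same mulr0.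
by rewrite (ltn_eqF kJ) mulr0.
Qed.

Lemma last_full_blocks (J : nat) : last_block J *m full_blocks J = 0.
Proof.
apply/matrixP => j l; rewrite !mxE big1// => k _; rewrite !mxE !Balpha_block.
case: (b k =P b J) => kJ; last by rewrite mul0r.
case: (b k =P b l) => [<-|_]; last by rewrite if_same mulr0.
by rewrite kJ ltnn mulr0.
Qed.

(** An [r] by [r] matrix with all entries [1/m] squares to [r/m] times itself; here [r] of the [m]
    indices survive the cut. *)
Lemma last_block_sqr (J : nat) : last_block J *m last_block J =
  ((J - blockStart alpha (b J))%:R / (alpha (b J).+1)%:R) *: last_block J.
Proof.
apply/matrixP => j l; rewrite !mxE -card_last_block.
transitivity (\sum_(k < J | b k == b J)
    (1 * ((alpha (b J).+1)%:R^-1 * last_block J j l))).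
  rewrite [RHS]big_mkcond; apply: eq_bigr => k _; rewrite !mxE !Balpha_block.
  case: (b k =P b J) => [->|_]; last by rewrite mul0r.
  rewrite mul1r [b l == _]eq_sym; case: (b J =P b l) => [<-|_]; last by rewrite !mulr0.
  by case: (b j =P b J) => [->//|_]; rewrite mulr0 mul0r.
by rewrite -mulr_suml mulrA !mxE.
Qed.

Lemma kerImProj_trunc (J : nat) :
  kerImProj (map_mx (real_complex R) (trunc (Balpha R alpha) J)) =
  map_mx (real_complex R) (full_blocks J).
Proof.
pose rho : R := (J - blockStart alpha (b J))%:R / (alpha (b J).+1)%:R.
rewrite trunc_Balpha map_mxD.
apply: (@kerImProj_idem_add _ _ _ _ (real_complex R rho)).
- by rewrite -map_mxM full_blocks_idem.
- by rewrite -map_mxM full_last_blocks map_mx0.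
- by rewrite -map_mxM last_full_blocks map_mx0.
- by rewrite -map_mxM last_block_sqr map_mxZ.
(* The index [J] belongs to the cut block but is not kept, so [rho < 1]. *)
rewrite fmorph_eq1; have /andP[AJ] := block_bounds J.
rewrite blockStartS -ltn_subLR// => JA.
by rewrite lt_eqF// ltr_pdivrMr ?mul1r ?ltr_nat// ltr0n.
Qed.

Lemma frakh_Balpha (mu : nat -> R) (J : nat) :
  frakh mu (Balpha R alpha) J = \sum_(n < b J) ln (alpha n.+1)%:R *
    \sum_(blockStart alpha n <= k < blockStart alpha n.+1) mu k.
Proof.
(* Minus the logarithm of an entry of a full block, set to 0 from the cut block on so that
   [sum_Balpha] applies. *)
pose g n : R := if (n < b J)%N then ln (alpha n.+1)%:R else 0.
have gJ n : (b J <= n)%N -> g n = 0 by rewrite /g ltnNge => ->.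
transitivity (\sum_(l < J) g (b l) * mu l); last first.
  under [RHS]eq_bigr => n _ do rewrite -(sum_block mu (ltn_ord n)) mulr_sumr big_mkcond.
  rewrite exchange_big; apply: eq_bigr => l _ /=; rewrite /g.
  case: ltnP => lJ; last first.
    rewrite mul0r big1// => n _; case: eqP => // ln.
    by have := ltn_ord n; rewrite -ln ltnNge lJ.
  rewrite (bigD1 (Ordinal lJ))//= eqxx big1 ?addr0// => n nl.
  by case: eqP => // ln; case/eqP: nl; apply/val_inj.
pose v := full_blocks J *m (\col_k mu k).
(* These column sums are the entries of [P^T e]: the indicator of the full blocks. *)
have rowE (j : 'I_J) : \sum_(i < J) full_blocks J i j = (b j < b J)%N%:R.
  transitivity (\sum_(i < J) Balpha R alpha i j * (b i < b J)%N%:R).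
    apply: eq_bigr => i _; rewrite mxE Balpha_block.
    by case: (b i =P b j) => [->|_]; case: ifP; rewrite ?mulr1 ?mulr0 ?mul0r.
  by rewrite (@sum_Balpha J j (fun n => (n < b J)%N%:R))// => n; rewrite ltnNge => ->.
rewrite /frakh kerImProj_trunc.
transitivity (- \sum_(j < J) \sum_(k < J) (b j < b J)%N%:R *
    Balpha R alpha j k * v k 0 * ln (Balpha R alpha j k)).
  have -> : map_mx (real_complex R) (full_blocks J) *m
      \col_k (real_complex R (mu k)) = map_mx (real_complex R) v.
    by rewrite /v map_mxM; congr (_ *m _); apply/matrixP => i j; rewrite !mxE.
  have uE : (map_mx (real_complex R) (full_blocks J))^T *m const_mx 1 =
      \col_j (real_complex R (b j < b J)%N%:R).
    apply/matrixP => j i; rewrite !mxE -rowE rmorph_sum.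
    by apply: eq_bigr => k _; rewrite !mxE mulr1.
  rewrite uE; set S := (X in - X); set S' := (X in _ = - X).
  suff -> : S = real_complex R S' by rewrite -rmorphN.
  rewrite rmorph_sum; apply: eq_bigr => j _; rewrite rmorph_sum.
  by apply: eq_bigr => k _; rewrite !mxE !rmorphM.
rewrite -sumrN.
transitivity (\sum_(k < J) g (b k) * v k 0).
  under eq_bigr do rewrite -sumrN.
  rewrite exchange_big; apply: eq_bigr => k _ /=.
  rewrite -(sum_Balpha k gJ) mulr_suml; apply: eq_bigr => j _.
  rewrite Balpha_block /g; case: ifP => _; last by rewrite !(mul0r, mulr0) oppr0.
  rewrite lnV ?posrE ?ltr0n//; case: ltnP => _; last by rewrite !(mul0r, mulr0) oppr0.
  by rewrite mul1r mulrN opprK mulrAC.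
(* A second averaging replaces the projected weights [v] by [mu] itself. *)
rewrite /v; under eq_bigr => k _ do rewrite mxE mulr_sumr.
rewrite exchange_big; apply: eq_bigr => l _ /=.
rewrite -(sum_Balpha l gJ) mulr_suml; apply: eq_bigr => k _.
rewrite !mxE Balpha_block; case: (b k =P b l) => [<-|_]; last first.
  by rewrite if_same !(mul0r, mulr0).
by rewrite /g; case: ifP => _; ring.
Qed.

End block_diagonal.

(** * The series of [n^(-3/2)] and of [n^(-1/2)] *)

Lemma powR_three_halves (R : realType) (x : R) :
  0 < x -> x `^ (3 / 2) = x * Num.sqrt x.
Proof.
move=> x0; have -> : 3 / 2 = 1 + 2^-1 :> R by lra.
by rewrite powRD ?(gt_eqF x0) ?implybT// powRr1 ?ltW// powR12_sqrt ?ltW.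
Qed.

(* Telescoping: [n^(-3/2) <= 2 ((n-1)^(-1/2) - n^(-1/2))] for [n > 1]. *)
Lemma series_riemannR_three_halves_le (R : realType) (n : nat) :
  series (riemannR (3 / 2 : R)) n.+1 <= 3 - 2 / Num.sqrt n.+1%:R.
Proof.
rewrite /series/=; elim: n => [|n IHn].
  by rewrite big_nat1 /riemannR powR1 sqrtr1 invr1; lra.
rewrite big_nat_recr//= {2}/riemannR powR_three_halves ?ltr0n//.
apply: (le_trans (lerD IHn (lexx _))).
set x : R := Num.sqrt n.+1%:R; set y : R := Num.sqrt n.+2%:R.
have x0 : 0 < x by rewrite sqrtr_gt0 ltr0n.
have y0 : 0 < y by rewrite sqrtr_gt0 ltr0n.
have x2 : x ^+ 2 = n.+1%:R by rewrite sqr_sqrtr ?ler0n.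
have y2 : y ^+ 2 = x ^+ 2 + 1 by rewrite sqr_sqrtr ?ler0n// x2 -[in LHS]addn1 natrD.
rewrite -[n.+2%:R](@sqr_sqrtr R) ?ler0n// -/y.
have xy : x <= y by nra.
rewrite -subr_ge0.
have -> : 3 - 2 / y - (3 - 2 / x + (y ^+ 2 * y)^-1) =
    (2 * y ^+ 3 - 2 * x * y ^+ 2 - x) / (x * y ^+ 3).
  by field; rewrite !lt0r_neq0.
apply: divr_ge0; last by rewrite mulr_ge0 ?exprn_ge0 ?ltW.
(* [y - x = 1 / (x + y)] and [x <= y] *)
have : (y - x) * (y + x) = 1 by rewrite -subr_sqr y2; ring.
nra.
Qed.

(** Convergence makes the [limn] in the definition of [C] the actual sum of the series. *)
Lemma is_cvg_series_riemannR_three_halves (R : realType) :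
  cvgn (series (riemannR (3 / 2 : R))).
Proof.
apply: nondecreasing_is_cvgn.
  by apply: nondecreasing_series => n _ _; rewrite ltW// riemannR_gt0// divr_ge0.
exists 3 => _ [n _ <-].
case: n => [|n]; first by rewrite /series/= big_geq.
rewrite (le_trans (series_riemannR_three_halves_le _ _))// gerBl.
by rewrite divr_ge0 ?sqrtr_ge0.
Qed.

Lemma lim_series_riemannR_three_halves_gt0 (R : realType) :
  0 < limn (series (riemannR (3 / 2 : R))).
Proof.
apply: (@lt_le_trans _ _ (series (riemannR (3 / 2 : R)) 1)).
  by rewrite /series/= big_nat1 /riemannR powR1 invr1.
apply: nondecreasing_cvgn_le; last exact: is_cvg_series_riemannR_three_halves.
by apply: nondecreasing_series => n _ _; rewrite ltW// riemannR_gt0// divr_ge0.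
Qed.

Lemma series_riemannR_half_cvgy (R : realType) :
  (series (riemannR (2^-1 : R)) @ \oo --> +oo)%classic.
Proof.
apply: nondecreasing_dvgn_lt; last by apply: dvg_riemannR; lra.
by apply: nondecreasing_series => n _ _; rewrite ltW// riemannR_gt0// invr_ge0.
Qed.

(** * Blocks of length [2^s] and their masses *)

Lemma blockStart_pow2 (alpha : nat -> nat) (n : nat) :
  (forall s, (1 <= s)%N -> alpha s = (2 ^ s)%N) ->
  blockStart alpha n = (2 ^ n.+1 - 2)%N.
Proof.
move=> alphaE; rewrite /blockStart; elim: n => [|n IHn]; first by rewrite big_geq.
rewrite big_nat_recr//= IHn alphaE// [in RHS]expnS.
by have := expn_gt0 2 n; rewrite expnS; lia.
Qed.

(** Since block [n] starts at [2^(n+1) - 2], it consists of the [j] with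
    [2^(n+1) <= j + 2 < 2^(n+2)]. *)
Lemma trunc_log2_block (alpha : nat -> nat) (j n : nat) :
  (forall s, (1 <= s)%N -> alpha s = (2 ^ s)%N) ->
  ((trunc_log 2 j.+2).-1 == n) =
  (blockStart alpha n <= j < blockStart alpha n.+1)%N.
Proof.
move=> alphaE; rewrite !blockStart_pow2//.
have := @trunc_log_bounds 2 j.+2 isT isT.
have : (0 < trunc_log 2 j.+2)%N by rewrite trunc_log_gt0.
case: (trunc_log 2 j.+2) => //= t _ /andP[tj jt].
have e2 m : (2 <= 2 ^ m.+1)%N by rewrite expnS; have := expn_gt0 2 m; lia.
have := e2 n; have := e2 n.+1 => n2 n1.
apply/eqP/andP => [<-|[nj jn]]; first by have := e2 t; have := e2 t.+1; lia.
have nt : (n.+1 < t.+2)%N by rewrite -(@ltn_exp2l 2)//; lia.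
have tn : (t.+1 < n.+2)%N by rewrite -(@ltn_exp2l 2)//; lia.
lia.
Qed.

(** The first index carries [c], and the other [n - m - 1] share another [c] equally; [m.+1 < n]
    ensures that there are others. *)
Lemma sum_halved_mass (R : realType) (mu : nat -> R) (c : R) (m n : nat) :
  (m.+1 < n)%N -> mu m = c ->
  (forall s, (m < s <= n - 1)%N -> mu s = 1 / (n%:R - m%:R - 1) * c) ->
  \sum_(m <= k < n) mu k = c + c.
Proof.
move=> mn mum mus; rewrite big_ltn ?(ltnW mn)// mum; congr (_ + _).
transitivity (\sum_(m.+1 <= k < n) (1 / (n%:R - m%:R - 1) * c)).
  by apply: eq_big_nat => s /andP[ms sn]; apply: mus; lia.
have dE : n%:R - m%:R - 1 = (n - m.+1)%:R :> R.
  by rewrite natrB ?(ltnW mn)// -[m.+1]addn1 natrD opprD addrA.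
rewrite sumr_const_nat dE -[LHS]mulr_natl mulrA mul1r divff ?mul1r//.
by rewrite pnatr_eq0 subn_eq0 -ltnNge.
Qed.

Theorem lemma9p8 (R : realType) (alpha A : nat -> nat) (C : R) (mu : nat -> R)
  (alphaE : forall s, (1 <= s)%N -> alpha s = (2 ^ s)%N)
  (AE : forall k, A k = blockStart alpha k)
  (CE : C = (limn (series (fun k : nat => 1 / (k.+1%:R `^ (3 / 2)) : R)))^-1)
  (mu_start : forall k, mu (A k) = C / (2 * k.+1%:R `^ (3 / 2)))
  (mu_in : forall k s, (A k < s <= A k.+1 - 1)%N ->
     mu s = 1 / ((A k.+1)%:R - (A k)%:R - 1) * (C / (2 * k.+1%:R `^ (3 / 2)))) :
  cvgn (fun J => (frakh mu (Balpha R alpha) J)%:E) /\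
  frakH mu (Balpha R alpha) = +oo%E.
Proof.
pose b j := (trunc_log 2 j.+2).-1.
have alpha_gt0 n : (0 < alpha n.+1)%N by rewrite alphaE// expn_gt0.
have bP j n : (b j == n) = (blockStart alpha n <= j < blockStart alpha n.+1)%N.
  exact: trunc_log2_block.
have C0 : 0 < C.
  rewrite CE invr_gt0; under eq_fun do rewrite div1r.
  exact: lim_series_riemannR_three_halves_gt0.
have massE n : \sum_(blockStart alpha n <= k < blockStart alpha n.+1) mu k =
    C / n.+1%:R `^ (3 / 2).
  rewrite -!AE (@sum_halved_mass _ _ (C / (2 * n.+1%:R `^ (3 / 2)))).
  - by have : n.+1%:R `^ (3 / 2) != 0 :> R by [rewrite gt_eqF// powR_gt0]; move=> h; field.
  - rewrite !AE blockStartS alphaE// expnS.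
    case: n => [|n]; first by rewrite /blockStart big_geq//.
    by have := expn_gt0 2 n; rewrite expnS; lia.
  - exact: mu_start.
  - exact: mu_in.
(* Block [n] contributes [(n+1) ln 2 * C / (n+1)^(3/2) = C ln 2 / (n+1)^(1/2)]. *)
have frakhE J : frakh mu (Balpha R alpha) J =
    C * ln 2 * series (riemannR (2^-1 : R)) (b J).
  rewrite (frakh_Balpha alpha_gt0 bP) /series/= big_mkord mulr_sumr.
  apply: eq_bigr => n _; rewrite massE alphaE// natrX lnXn ?ltr0n//.
  rewrite powR_three_halves ?ltr0n// /riemannR powR12_sqrt ?ler0n// -[ln 2 *+ _]mulr_natl.
  have s0 : Num.sqrt (n.+1%:R : R) != 0 by rewrite gt_eqF// sqrtr_gt0 ltr0n.
  have n0 : n.+1%:R != 0 :> R by rewrite pnatr_eq0.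
  by field; rewrite s0 nat1r.
have hy : ((frakh mu (Balpha R alpha) J)%:E @[J --> \oo] --> +oo%E)%classic.
  apply/cvgeryP; rewrite (funext frakhE : frakh mu (Balpha R alpha) = _).
  have Cln2 : 0 < C * ln 2 by rewrite mulr_gt0// ln_gt0// ltr1n.
  pose u := series (riemannR (2^-1 : R)) \o b.
  apply: (cvg_comp u (fun r => C * ln 2 * r) _ (gt0_cvgMry Cln2 (f := id) cvg_id)).
  apply: cvg_comp; last exact: (@series_riemannR_half_cvgy R).
  (* The number [b J] of full blocks tends to infinity: it is at least [m] once [J] reaches the
     start of block [m]. *)
  apply/cvgnyPge => m; near=> J.
  have : (blockStart alpha m <= J)%N by near: J; exact: nbhs_infty_ge.
  move=> /(leq_block bP).
  have /eqP -> // : b (blockStart alpha m) == m.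
  by rewrite bP leqnn blockStartS -[ltnLHS]addn0 ltn_add2l alpha_gt0.
by split; [exact: cvgP hy | exact: cvg_lim hy].
Unshelve. all: by end_near.
Qed.
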